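(* Let $\mathcal G$ be a locally compact group acting transitively on a set $\mathcal X$, let $\mathcal A$ be a finite set of outcomes, let $x_0\in\mathcal X$, and let $\mathrm P$ be a $\mathcal G$-box, i.e. a family of probability distributions $\mathrm P(\cdot\,|\,x)$ on $\mathcal A$ indexed by $x\in\mathcal X$. Suppose that ensembles of the boxes obtained from $\mathrm P$ by transformations in $\mathcal G$ are characterized by finitely many parameters, i.e. that the real linear span of the functions $\{\mathrm P\circ R : R\in\mathcal G\}$, where $(\mathrm P\circ R)(a|x):=\mathrm P(a|Rx)$, is a finite-dimensional vector space. For $R\in\mathcal G$ write $x_R:=Rx_0$. Then there exist an integer $D$ and a representation $R\mapsto T_R$ of $\mathcal G$ by real orthogonal $D\times D$ matrices such that for each outcome $a\in\mathcal A$ the outcome probabilities are a linear combination, fixed over $R$, of the matrix entries of $T_R$: there are real constants $k^a_{ij}$, independent of $R$, with $$\mathrm P(a\,|\,x_R)=\sum_{i,j=1}^{D}k^a_{ij}\,(T_R)_{ij}\qquad\text{for all }R\in\mathcal G,\ a\in\mathcal A .$$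
   Context: A black box with input set $\mathcal X$ and finite output set $\mathcal A$ is a map assigning to each $x\in\mathcal X$ a probability distribution $\mathrm P(\cdot|x)$ on $\mathcal A$; it is regarded as a bounded function $\mathcal X\to\mathbb R^{|\mathcal A|}$. It is called a $\mathcal G$-box if the group $\mathcal G$ acts transitively on $\mathcal X$ (so $\mathcal X=\mathcal G/\mathcal H$ is a homogeneous space). A representation by real orthogonal matrices is a group homomorphism from $\mathcal G$ to the orthogonal group $O(D)$. *)

(* Defs.v *)
From HB Require Import structures.
From mathcomp Require Import all_boot all_order all_algebra.
From mathcomp Require Import all_classical all_reals all_analysis.

Set Implicit Arguments.
Unset Strict Implicit.
Unset Printing Implicit Defensive.

Import Order.TTheory GRing.Theory Num.Theory.

Local Open Scope classical_set_scope.
Local Open Scope ring_scope.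

(* The multiplicative counterpart of [topologicalZmodType]. As for
   [topologicalType], no separation axiom is required. *)
HB.mixin Record Group_isTopologicalGroup G & Topological G & Group G := {
  mulg_continuous : continuous (fun x : G * G => (x.1 * x.2)%g) ;
  invg_continuous : continuous (fun x : G => x^-1%g) ;
}.

#[short(type="topologicalGroupType")]
HB.structure Definition TopologicalGroup :=
  {G of Topological G & Group G & Group_isTopologicalGroup G}.

Definition left_action (G : groupType) (X : Type) (act : G -> X -> X) : Prop :=
  (forall x, act 1%g x = x) /\
  (forall g h x, act (g * h)%g x = act g (act h x)).

Definition transitive_action (G : groupType) (X : Type) (act : G -> X -> X) :
    Prop :=
  left_action act /\ (forall x y, exists g, act g x = y).

Definition linear_span (K : fieldType) (V : lmodType K) (S : set V) : set V :=
  [set v | exists n (c : 'I_n -> K) (u : 'I_n -> V),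
     (forall i, S (u i)) /\ v = \sum_i c i *: u i].

Definition linearly_independent (K : fieldType) (V : lmodType K) (n : nat)
    (b : 'I_n -> V) : Prop :=
  forall c : 'I_n -> K, \sum_i c i *: b i = 0 -> forall i, c i = 0.

Definition finite_dimensional (K : fieldType) (V : lmodType K) (W : set V) :
    Prop :=
  exists n (b : 'I_n -> V),
    linearly_independent b /\ linear_span (range b) = W.

(* [P x a] is the probability P(a|x). The codomain [R^o] only serves to give
   [X -> A -> R^o] its pointwise vector space structure over [R]. *)
Definition black_box (R : realType) (X : Type) (A : finType)
    (P : X -> A -> R^o) : Prop :=
  forall x, (forall a, 0 <= P x a) /\ \sum_a P x a = 1.

Definition box_orbit (R : realType) (G : groupType) (X : Type) (A : finType)
    (act : G -> X -> X) (P : X -> A -> R^o) : set (X -> A -> R^o) :=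
  range (fun g : G => P \o act g).

Definition orthogonal_mx (R : realType) (D : nat) (M : 'M[R]_D) : Prop :=
  M^T *m M = 1%:M /\ M *m M^T = 1%:M.

Definition orthogonal_representation (R : realType) (G : groupType) (D : nat)
    (T : G -> 'M[R]_D) : Prop :=
  [/\ forall g, orthogonal_mx (T g),
      T 1%g = 1%:M
    & forall g h, T (g * h)%g = T g *m T h].

(* Main.v *)
(* In a basis (b_i) of the span W of the orbit of P, translation by g has a
   matrix M g, and g |-> M g is a representation for which P(a|g x0) is a linear
   combination of the entries of M g. The functions b_i are bounded, and finitely
   many points of X * A suffice to recover the coordinates of an element of W
   from its values, so the matrices M g are uniformly bounded. A bounded matrix
   group preserves a positive definite form S: no averaging over G is available,
   since G need not be compact and M need not be continuous, so S is obtained as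
   the circumcenter-type point of an invariant closed convex set of uniformly
   coercive forms, namely the one whose orbit has least radius for the Frobenius
   norm; the parallelogram identity gives existence and invariance. Writing
   S = B^T B, the matrices B (M g) B^-1 are orthogonal. *)
Require Import Defs.
From mathcomp Require Import all_boot all_order all_algebra.
From mathcomp Require Import all_classical all_reals all_analysis.
From mathcomp Require Import ring lra.
Local Open Scope classical_set_scope.
Local Open Scope ring_scope.
Set Implicit Arguments.
Unset Strict Implicit.
Unset Printing Implicit Defensive.
Import Order.TTheory GRing.Theory Num.Theory.
Import numFieldNormedType.Exports.

(** * Cauchy-Schwarz and the squared Frobenius norm *)

Lemma sum_mul_sqr_le (R : realFieldType) (I : finType) (a b : I -> R) :
  (\sum_i a i * b i) ^+ 2 <= (\sum_i a i ^+ 2) * (\sum_i b i ^+ 2).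
Proof.
(* Lagrange's identity *)
have : 0 <= \sum_i \sum_j (a i * b j - a j * b i) ^+ 2.
  by apply: sumr_ge0 => i _; apply: sumr_ge0 => j _; exact: sqr_ge0.
under eq_bigr => i _.
  rewrite (eq_bigr (fun j => a i ^+ 2 * b j ^+ 2 + b i ^+ 2 * a j ^+ 2
    + (-2) * (a i * b i) * (a j * b j))); last by move=> j _; ring.
  rewrite !big_split /= -!mulr_sumr.
  over.
rewrite !big_split /= -!mulr_suml -mulr_sumr; lra.
Qed.

Definition sqnorm (R : realFieldType) m n (A : 'M[R]_(m, n)) : R :=
  \sum_i \sum_j A i j ^+ 2.

Section Sqnorm.
Variable R : realFieldType.

Lemma sqnorm_ge0 m n (A : 'M[R]_(m, n)) : 0 <= sqnorm A.
Proof. by do 2!apply: sumr_ge0 => ? _; exact: sqr_ge0. Qed.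

Lemma sqr_entry_le m n (A : 'M[R]_(m, n)) i j : A i j ^+ 2 <= sqnorm A.
Proof.
rewrite /sqnorm (bigD1 i) //= (bigD1 j) //= -addrA lerDl addr_ge0 //.
  by apply: sumr_ge0 => ? _; exact: sqr_ge0.
by do 2!apply: sumr_ge0 => ? _; exact: sqr_ge0.
Qed.

Lemma sqnorm_eq0 m n (A : 'M[R]_(m, n)) : sqnorm A = 0 -> A = 0.
Proof.
move=> A0; apply/matrixP => i j; rewrite mxE; apply/eqP.
by rewrite -sqrf_eq0 eq_le sqr_ge0 -A0 sqr_entry_le.
Qed.

Lemma sqnorm_tr m n (A : 'M[R]_(m, n)) : sqnorm A^T = sqnorm A.
Proof.
rewrite /sqnorm exchange_big.
by apply: eq_bigr => i _; apply: eq_bigr => j _; rewrite mxE.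
Qed.

(** Cauchy-Schwarz bounds each entry of the product by a row of [A] and a column of [B]. *)
Lemma sqnorm_mul m n p (A : 'M[R]_(m, n)) (B : 'M[R]_(n, p)) :
  sqnorm (A *m B) <= sqnorm A * sqnorm B.
Proof.
rewrite -(sqnorm_tr B) /sqnorm big_distrlr; apply: ler_sum => i _.
apply: ler_sum => j _; rewrite mxE.
rewrite [X in _ <= _ * X](eq_bigr (fun k => B k j ^+ 2)).
  exact: sum_mul_sqr_le.
by move=> k _; rewrite mxE.
Qed.

Lemma sqnorm_parallelogram m n (A B : 'M[R]_(m, n)) :
  sqnorm (A - B) = 2 * sqnorm A + 2 * sqnorm B - 4 * sqnorm (2^-1 *: (A + B)).
Proof.
rewrite /sqnorm !mulr_sumr -sumrN -!big_split /=; apply: eq_bigr => i _.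
rewrite !mulr_sumr -sumrN -!big_split /=; apply: eq_bigr => j _.
by rewrite !mxE; field.
Qed.

Lemma quadratic_formE n (S : 'M[R]_n) (x : 'cV[R]_n) :
  (x^T *m S *m x) 0 0 = \sum_i \sum_j x i 0 * S i j * x j 0.
Proof.
rewrite mxE exchange_big; apply: eq_bigr => j _; rewrite mxE mulr_suml.
by apply: eq_bigr => i _; rewrite mxE.
Qed.

End Sqnorm.

(** * Cholesky factorization *)

Lemma cholesky (R : rcfType) n (S : 'M[R]_n) :
  S^T = S -> (forall x : 'cV[R]_n, x != 0 -> 0 < (x^T *m S *m x) 0 0) ->
  exists2 B : 'M[R]_n, B \in unitmx & S = B^T *m B.
Proof.
elim: n S => [|n IHn] S symS posS.
  by exists 1%:M; [exact: unitmx1 | apply/matrixP => -[]].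
rewrite -[n.+1]/(1 + n)%N in S symS posS *.
set a := ulsubmx S 0 0; set b := ursubmx S; set d := drsubmx S.
have Sul : ulsubmx S = a%:M by exact: mx11_scalar.
have Sdl : dlsubmx S = b^T by rewrite -[in LHS]symS -trmx_ursub.
have SE : S = block_mx a%:M b b^T d by rewrite -Sul -Sdl submxK.
have symd : d^T = d by rewrite -[in RHS]/d /d trmx_drsub symS.
have a_gt0 : 0 < a.
  have /posS : col_mx (1%:M : 'M[R]_1) (0 : 'cV[R]_n) != 0.
    by rewrite col_mx_eq0 negb_and oner_neq0.
  rewrite SE tr_col_mx mul_row_block !trmx1 !trmx0 !mul0mx !addr0 !mul1mx.
  by rewrite mul_row_col mulmx1 mulmx0 addr0 mxE mulr1n.
have a_neq0 : a != 0 by rewrite gt_eqF.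
(* Induction on the Schur complement of [a]: its value at [y] is that of [S] at the vector with
   blocks [- a^-1 *: (b *m y)] and [y], hence positive for nonzero [y]. *)
have [||B' B'unit dE] := IHn (d - a^-1 *: (b^T *m b)).
- by rewrite linearB /= linearZ /= trmx_mul trmxK symd.
- move=> y y_neq0.
  have /posS : col_mx (- (a^-1 *: (b *m y)) : 'M[R]_1) y != 0.
    by rewrite col_mx_eq0 negb_and y_neq0 orbT.
  rewrite SE -mulmxA mul_block_col tr_col_mx mul_row_col.
  rewrite mul_scalar_mx scalerN scalerA divff // scale1r addNr mulmx0 add0r.
  congr (0 < _); rewrite -mulmxA; congr ((_ *m _) 0 0).
  by rewrite mulmxBl mulmxN -scalemxAr -scalemxAl mulmxA addrC.
pose s := Num.sqrt a.
have s_neq0 : s != 0 by rewrite gt_eqF // sqrtr_gt0.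
have ssE : s * s = a by rewrite -expr2 sqr_sqrtr // ltW.
exists (block_mx s%:M (s^-1 *: b) 0 B').
  by rewrite unitmxE det_ublock det_scalar1 unitrM unitfE s_neq0 -unitmxE.
rewrite SE tr_block_mx mulmx_block !trmx0 !tr_scalar_mx !mul0mx !mulmx0 !addr0.
rewrite -scalar_mxM ssE mul_scalar_mx scalerA divff // scale1r.
rewrite linearZ /= mul_mx_scalar scalerA divff // scale1r.
by rewrite -dE -scalemxAl -scalemxAr scalerA -invfM ssE addrC subrK.
Qed.

(** * Entrywise convergence of matrices *)

Lemma cvg_sum (R : realType) (I : finType) (u_ : I -> nat -> R) (u : I -> R) :
  (forall i, u_ i k @[k --> \oo] --> u i) ->
  \sum_i u_ i k @[k --> \oo] --> \sum_i u i.
Proof. by move=> u_u; apply: cvg_big => //; exact: add_continuous. Qed.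

Lemma cvg_mulmx_entry (R : realType) m n p q (A : 'M[R]_(m, n))
    (S_ : nat -> 'M[R]_(n, p)) (S : 'M[R]_(n, p)) (B : 'M[R]_(p, q)) :
  (forall i j, S_ k i j @[k --> \oo] --> S i j) ->
  forall i j, (A *m S_ k *m B) i j @[k --> \oo] --> (A *m S *m B) i j.
Proof.
move=> S_S i j; rewrite mxE; under eq_fun do rewrite mxE.
apply: cvg_sum => l; apply: cvgMr_tmp.
rewrite mxE; under eq_fun do rewrite mxE.
by apply: cvg_sum => r; exact: cvgMl_tmp.
Qed.

Lemma cvg_sqnorm (R : realType) m n (S_ : nat -> 'M[R]_(m, n))
    (S : 'M[R]_(m, n)) :
  (forall i j, S_ k i j @[k --> \oo] --> S i j) ->
  sqnorm (S_ k) @[k --> \oo] --> sqnorm S.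
Proof.
move=> S_S; apply: cvg_sum => i; apply: cvg_sum => j.
by rewrite expr2; under eq_fun do rewrite expr2; apply: cvgM; exact: S_S.
Qed.

(** Each squared entry is at most [sqnorm], so every entry is a real Cauchy sequence. The rate
    [harmonic k], that is 1/(k+1), is the defect of the minimizing sequence used below. *)
Lemma sqnorm_cauchy_cvg (R : realType) m n (S_ : nat -> 'M[R]_(m, n))
    (c : R) :
  (forall k l, (k <= l)%N -> sqnorm (S_ k - S_ l) <= c * harmonic k) ->
  exists S : 'M[R]_(m, n), forall i j, S_ k i j @[k --> \oo] --> S i j.
Proof.
move=> S_near.
have c_cvg : c * harmonic k @[k --> \oo] --> (0 : R).
  by rewrite -[X in _ --> X](mulr0 c); apply: cvgMl_tmp; exact: cvg_harmonic.
have entry_cvg i j : cvg (S_ k i j @[k --> \oo]).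
  apply/cauchy_cvgP/cauchy_exP => e e_gt0.
  have e2_gt0 : 0 < e ^+ 2 by rewrite exprn_gt0.
  have [N _ HN] := (cvgrPdist_lt _ _).1 c_cvg _ e2_gt0.
  exists (S_ N i j); exists N => // k /= Nk.
  rewrite /ball /= -(ltr_pXn2r (n := 2)) ?nnegrE ?normr_ge0 ?(ltW e_gt0) //.
  rewrite real_normK ?num_real //.
  apply: le_lt_trans (_ : c * harmonic N < _).
    apply: le_trans (S_near _ _ Nk).
    by apply: le_trans (sqr_entry_le _ i j); rewrite !mxE.
  apply: le_lt_trans (HN N (leqnn N)).
  by rewrite sub0r normrN ler_norm.
exists (\matrix_(i, j) limn (fun k => S_ k i j)) => i j.
by rewrite mxE; exact: entry_cvg.
Qed.

(** * An invariant form for a bounded matrix group *)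

Section InvariantForm.
Variables (R : realType) (G : groupType) (n : nat) (M : G -> 'M[R]_n) (C : R).
Hypothesis M1 : M 1%g = 1%:M.
Hypothesis MM : forall g h, M (g * h)%g = M g *m M h.
Hypothesis M_bounded : forall g, sqnorm (M g) <= C.

(** The pullback of a form along [M g]; this is a right action, hence the swapped order in
    [actM]. *)
Let act (g : G) (S : 'M[R]_n) := (M g)^T *m S *m M g.

Let act1 S : act 1%g S = S.
Proof. by rewrite /act M1 trmx1 mul1mx mulmx1. Qed.

Let actM g h S : act (g * h)%g S = act h (act g S).
Proof. by rewrite /act MM trmx_mul !mulmxA. Qed.

Let act_sub g S S' : act g (S - S') = act g S - act g S'.
Proof. by rewrite /act mulmxBr mulmxBl. Qed.

Let act_mid g S S' :
  act g (2^-1 *: (S + S')) = 2^-1 *: (act g S + act g S').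
Proof. by rewrite /act -scalemxAr -scalemxAl mulmxDr mulmxDl. Qed.

Let C_ge0 : 0 <= C.
Proof. exact: le_trans (sqnorm_ge0 _) (M_bounded 1%g). Qed.

Let sqnorm_act g S : sqnorm (act g S) <= C ^+ 2 * sqnorm S.
Proof.
apply: le_trans (sqnorm_mul _ _) _.
rewrite mulrC expr2 -mulrA; apply: ler_pM => //; try exact: sqnorm_ge0.
apply: le_trans (sqnorm_mul _ _) _.
by rewrite sqnorm_tr ler_wpM2r // sqnorm_ge0.
Qed.

Let sqnorm_le_act g S : sqnorm S <= C ^+ 2 * sqnorm (act g S).
Proof.
by rewrite -[in leLHS](act1 S) -(mulgV g) actM; exact: sqnorm_act.
Qed.

(** Quantifying over the whole orbit makes the condition invariant, and the uniform constant lets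
    positivity survive limits. *)
Let coercive (S : 'M[R]_n) := S^T = S /\
  forall g (x : 'cV[R]_n), sqnorm x <= C * (x^T *m act g S *m x) 0 0.

(** Since x = [M g^-1] ([M g] x), the bound on [M g^-1] controls x by [M g *m x]. *)
Let coercive1 : coercive 1%:M.
Proof.
split=> [|g x]; first exact: trmx1.
rewrite /act mulmx1.
have -> : (x^T *m ((M g)^T *m M g) *m x) 0 0 = sqnorm (M g *m x).
  rewrite mulmxA -trmx_mul -mulmxA mxE; apply: eq_bigr => i _.
  by rewrite big_ord1 [X in X * _]mxE expr2.
rewrite -[in leLHS](mul1mx x) -M1 -(mulVg g) MM -mulmxA.
by apply: le_trans (sqnorm_mul _ _) _; rewrite ler_wpM2r ?sqnorm_ge0.
Qed.

Let coercive_act g S : coercive S -> coercive (act g S).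
Proof.
move=> [symS coS]; split=> [|h x]; last by rewrite -actM.
by rewrite /act !trmx_mul trmxK symS mulmxA.
Qed.

Let coercive_mid S S' :
  coercive S -> coercive S' -> coercive (2^-1 *: (S + S')).
Proof.
move=> [symS coS] [symS' coS']; split=> [|h x].
  by rewrite linearZ /= linearD /= symS symS'.
rewrite act_mid -scalemxAr -scalemxAl mulmxDr mulmxDl !mxE.
by move: (coS h x) (coS' h x); rewrite !mxE; lra.
Qed.

(* [m] is the infimum, over the invariant convex set of coercive forms [S], of
   the squared radius of the orbit of [S]. *)
Let bounds := [set t | exists2 S, coercive S &
  forall g, sqnorm (act g S) <= t].

Let m := inf bounds.

Let has_inf_bounds : has_inf bounds.
Proof.
split.
  by exists (C ^+ 2 * sqnorm (1%:M : 'M[R]_n)), 1%:M => // g; exact: sqnorm_act.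
exists 0 => t [S _ /(_ 1%g)]; exact: le_trans (sqnorm_ge0 _).
Qed.

Let near_center (e : R) S :=
  coercive S /\ forall g, sqnorm (act g S) <= m + e.

Let near_center_ex e : 0 < e -> exists S, near_center e S.
Proof.
move=> e_gt0; have [t [S coS St] tm] := inf_adherent e_gt0 has_inf_bounds.
by exists S; split=> // g; exact: le_trans (St g) (ltW tm).
Qed.

Let near_center_act e g S : near_center e S -> near_center e (act g S).
Proof.
by move=> [coS Se]; split=> [|h]; [exact: coercive_act | rewrite -actM].
Qed.

(* If both [S] and [S'] almost minimize the orbit radius, so does their midpoint
   up to the parallelogram defect, whence they are close to each other. *)
Let near_center_close e S S' : 0 < e -> near_center e S -> near_center e S' ->
  sqnorm (S - S') <= C ^+ 2 * 8 * e.
Proof.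
move=> e_gt0 [coS Se] [coS' S'e].
(* The midpoint is coercive, so [m - e] cannot bound its orbit, [m] being the infimum. *)
have [g Hg] : exists g, m - e < sqnorm (act g (2^-1 *: (S + S'))).
  apply: contrapT => /forallNP small.
  have : bounds (m - e).
    exists (2^-1 *: (S + S')); first exact: coercive_mid.
    by move=> g; rewrite leNgt; apply/negP; exact: small.
  by move=> /(ge_inf has_inf_bounds.2); rewrite -/m; lra.
apply: le_trans (sqnorm_le_act g _) _.
(* The factor 8 comes from 2(m + e) + 2(m + e) - 4(m - e) = 8e. *)
rewrite -mulrA ler_wpM2l ?sqr_ge0 // act_sub sqnorm_parallelogram -act_mid.
by have := Se g; have := S'e g; lra.
Qed.

Lemma invariant_form : exists S : 'M[R]_n,
  [/\ S^T = S,
      forall x : 'cV[R]_n, x != 0 -> 0 < (x^T *m S *m x) 0 0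
    & forall g, (M g)^T *m S *m M g = S].
Proof.
have /choice [S_ S_P] k : exists S, near_center (harmonic k) S.
  exact/near_center_ex/harmonic_gt0.
have harmonic_mono k l : (k <= l)%N -> harmonic l <= harmonic k :> R.
  by move=> kl; rewrite /= lef_pV2 ?posrE // ler_nat ltnS.
have near_center_le k l S : (k <= l)%N -> near_center (harmonic l) S ->
    near_center (harmonic k) S.
  move=> kl [coS Sl]; split=> // g; apply: le_trans (Sl g) _.
  by rewrite lerD2l harmonic_mono.
have [|S S_S] := sqnorm_cauchy_cvg (S_ := S_) (c := C ^+ 2 * 8).
  move=> k l kl; apply: near_center_close (harmonic_gt0 k) (S_P k) _.
  exact: near_center_le kl (S_P l).
have act_cvg g i j : (act g (S_ k)) i j @[k --> \oo] --> (act g S) i j.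
  exact: cvg_mulmx_entry.
exists S; split.
- apply/matrixP => i j; rewrite mxE.
  have symS_ k : S_ k j i = S_ k i j by rewrite -[in LHS](S_P k).1.1 mxE.
  have S_ji : S_ k i j @[k --> \oo] --> S j i.
    by have := S_S j i; under eq_fun do rewrite symS_.
  exact: cvg_unique S_ji (S_S i j).
- move=> x x_neq0.
  (* The uniform coercivity bound passes to the limit; as [C] is nonnegative, it forces the form to
     be positive at [x]. *)
  have le_x : sqnorm x <= C * (x^T *m S *m x) 0 0.
    have cv : C * (x^T *m S_ k *m x) 0 0 @[k --> \oo] -->
        C * (x^T *m S *m x) 0 0.
      by apply: cvgMl_tmp; exact: cvg_mulmx_entry.
    apply: (cvgr_to_ge cv); apply: nearW => k.
    by have := (S_P k).1.2 1%g x; rewrite act1.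
  have x_gt0 : 0 < sqnorm x.
    rewrite lt_neqAle sqnorm_ge0 andbT eq_sym; apply/eqP => /sqnorm_eq0 x0.
    by rewrite x0 eqxx in x_neq0.
  by have := C_ge0; have := lt_le_trans x_gt0 le_x; nra.
(* [S_ k] and its translate by [g] are both near centers with defect [harmonic k], so their distance
   tends to 0. *)
- move=> g; rewrite -/(act g S); apply/eqP; rewrite -subr_eq0; apply/eqP.
  apply: sqnorm_eq0; apply/eqP; rewrite eq_le sqnorm_ge0 andbT.
  have cv : sqnorm (act g (S_ k) - S_ k) @[k --> \oo] --> sqnorm (act g S - S).
    apply: cvg_sqnorm => i j; rewrite !mxE; under eq_fun do rewrite !mxE.
    apply: cvgB; last exact: S_S.
    by have := act_cvg g i j; rewrite mxE; under eq_fun do rewrite mxE.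
  have c_cvg : C ^+ 2 * 8 * harmonic k @[k --> \oo] --> (0 : R).
    rewrite -[X in _ --> X](mulr0 (C ^+ 2 * 8)).
    by apply: cvgMl_tmp; exact: cvg_harmonic.
  apply: (ler_cvg_to cv c_cvg); apply: nearW => k.
  apply: near_center_close (harmonic_gt0 k) _ (S_P k).
  exact: near_center_act (S_P k).
Qed.

End InvariantForm.

(** * Finitely many separating points, and linear spans *)

Lemma separating_points (K : fieldType) (Z : Type) n (f : 'I_n -> Z -> K) :
  (forall c : 'I_n -> K, (forall z, \sum_i c i * f i z = 0) ->
    forall i, c i = 0) ->
  exists m (z : 'I_m -> Z), row_full (\matrix_(k, i) f i (z k)).
Proof.
move=> free_f.
(* A matrix of evaluations of rank r < n kills some v <> 0; a point where
   [\sum_i v_i f_i] does not vanish gives a row outside its row space. *)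
suff rank_ge r : (r <= n)%N -> exists m (z : 'I_m -> Z),
    (r <= \rank (\matrix_(k, i) f i (z k)))%N.
  have [m [z n_le]] := rank_ge n (leqnn n); exists m, z.
  by rewrite /row_full eqn_leq rank_leq_col.
elim: r => [_|r IHr rn].
  (* The empty family of points has to exist even when [Z] is empty. *)
  by exists 0%N, (fun k : 'I_0 => False_rect Z (notF (ltn_ord k))).
have [m [z]] := IHr (ltnW rn); set V := \matrix_(_, _) _.
rewrite leq_eqVlt => /predU1P[rE|]; last by exists m, z.
have : kermx V^T != 0.
  by rewrite kermx_eq0 /row_free mxrank_tr -rE neq_ltn rn.
case/rowV0Pn => v /sub_kermxP vV v_neq0.
have [z0 vz0] : exists z0, \sum_i v 0 i * f i z0 != 0.
  apply: contrapT => /forallNP v0; case/eqP: v_neq0; apply/rowP => i.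
  rewrite mxE; apply: (free_f (v 0)) => z0.
  by apply/eqP/negPn/negP; exact: v0.
pose z' (k : 'I_(1 + m)) := if fintype.split k is inr l then z l else z0.
exists (1 + m)%N, z'.
pose w : 'rV[K]_n := \row_i f i z0.
have -> : \matrix_(k, i) f i (z' k) = col_mx w V.
  by apply/matrixP => k i; rewrite !mxE /z'; case: fintype.split => l; rewrite mxE.
rewrite rE; apply: rank_ltmx.
rewrite ltmxE col_mx_sub submx_refl andbT -addsmxE addsmxSr /=.
apply/negP => /submxP[d wE]; case/eqP: vz0.
have : w *m v^T = 0 by rewrite wE -mulmxA -[V]trmxK -trmx_mul vV trmx0 mulmx0.
move/matrixP/(_ 0 0); rewrite !mxE => wv0; rewrite -[RHS]wv0.
by apply: eq_bigr => i _; rewrite !mxE mulrC.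
Qed.

Lemma sub_linear_span (K : fieldType) (V : lmodType K) (S : set V) :
  S `<=` linear_span S.
Proof.
move=> v Sv; exists 1%N, (fun=> 1), (fun=> v); split=> //.
by rewrite big_ord1 scale1r.
Qed.

Lemma linear_span_range (K : fieldType) (V : lmodType K) n (b : 'I_n -> V) v :
  linear_span (range b) v -> exists c : 'I_n -> K, v = \sum_i c i *: b i.
Proof.
move=> [m [c [u [/= u_b ->]]]].
have /choice[s sP] : forall k, exists i, b i = u k.
  by move=> k; have [i _ <-] := u_b k; exists i.
(* Terms that use the same [b i] are merged into one coefficient. *)
exists (fun i => \sum_(k | s k == i) c k).
rewrite (partition_big s xpredT) //=; apply: eq_bigr => i _.
by rewrite scaler_suml; apply: eq_bigr => k /eqP <-; rewrite sP.
Qed.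

(** * The translation representation on the span of the orbit *)

Section BoxSpace.
Variables (R : realType) (G : groupType) (X : Type) (A : finType).
Variables (act : G -> X -> X) (P : X -> A -> R^o).
Hypothesis act_left : left_action act.
Hypothesis P_box : black_box P.

Lemma box_le1 x a : `|P x a| <= 1.
Proof.
have [P_ge0 P1] := P_box x; rewrite ger0_norm // -P1 (bigD1 a) //= lerDl.
by apply: sumr_ge0.
Qed.

Lemma eval_sum n (c : 'I_n -> R) (u : 'I_n -> X -> A -> R^o) x a :
  (\sum_i c i *: u i) x a = \sum_i c i * u i x a.
Proof. by rewrite !fct_sumE. Qed.

Lemma span_orbit_bounded v : linear_span (box_orbit act P) v ->
  exists beta : R, forall x a, `|v x a| <= beta.
Proof.
move=> [m [c [u [u_orb ->]]]]; exists (\sum_k `|c k|) => x a.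
rewrite eval_sum (le_trans (ler_norm_sum _ _ _)) //; apply: ler_sum => k _.
rewrite normrM ler_piMr //; have [g _ <-] := u_orb k; exact: box_le1.
Qed.

Lemma span_orbit_comp v g : linear_span (box_orbit act P) v ->
  linear_span (box_orbit act P) (v \o act g).
Proof.
move=> [m [c [u [u_orb ->]]]]; exists m, c, (fun k => u k \o act g); split.
  move=> k; have [h _ <-] := u_orb k; exists (h * g)%g => //.
  by apply/funext => x /=; rewrite act_left.2.
by apply/funext => x; apply/funext => a /=; rewrite !eval_sum.
Qed.

Section Coordinates.
Variables (n : nat) (b : 'I_n -> X -> A -> R^o).
Hypothesis b_free : linearly_independent b.
Hypothesis b_span : linear_span (range b) = linear_span (box_orbit act P).

Lemma coord_inj (c d : 'I_n -> R) :
  (forall x a, \sum_i c i * b i x a = \sum_i d i * b i x a) -> c =1 d.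
Proof.
move=> cd i; apply/eqP; rewrite -subr_eq0; apply/eqP.
apply: (b_free (c := fun i => c i - d i)).
apply/funext => x; apply/funext => a; rewrite eval_sum.
under eq_bigr do rewrite mulrBl.
by rewrite sumrB cd subrr.
Qed.

Lemma span_orbit_basis i : linear_span (box_orbit act P) (b i).
Proof. by rewrite -b_span; apply: sub_linear_span; exists i. Qed.

(** Row i of [M g] holds the coordinates of [b i \o act g]; with rows rather than columns, [M]
    preserves the order of products. *)
Lemma coord_mx : exists M : G -> 'M[R]_n,
  forall g i x a, b i (act g x) a = \sum_j M g i j * b j x a.
Proof.
have /choice[M MP] : forall g, exists M : 'M[R]_n,
    forall i x a, b i (act g x) a = \sum_j M i j * b j x a.
  move=> g.
  have /choice[c cP] : forall i, exists c : 'I_n -> R,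
      b i \o act g = \sum_j c j *: b j.
    move=> i; apply: linear_span_range.
    by rewrite b_span; apply: span_orbit_comp; exact: span_orbit_basis.
  exists (\matrix_(i, j) c i j) => i x a.
  have := congr1 (fun f => f x a) (cP i); rewrite /= eval_sum => ->.
  by apply: eq_bigr => j _; rewrite mxE.
by exists M.
Qed.

Variable M : G -> 'M[R]_n.
Hypothesis M_coord :
  forall g i x a, b i (act g x) a = \sum_j M g i j * b j x a.

Lemma coord_mx1 : M 1%g = 1%:M.
Proof.
apply/matrixP => i; apply: coord_inj => x a.
rewrite -M_coord act_left.1 (bigD1 i) //= mxE eqxx mul1r big1 ?addr0 //.
by move=> j ji; rewrite mxE eq_sym (negPf ji) mul0r.
Qed.

Lemma coord_mxM g h : M (g * h)%g = M g *m M h.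
Proof.
apply/matrixP => i; apply: coord_inj => x a.
rewrite -M_coord act_left.2 M_coord.
under eq_bigr do rewrite M_coord mulr_sumr.
rewrite exchange_big; apply: eq_bigr => k _.
by rewrite mxE mulr_suml; apply: eq_bigr => j _; rewrite mulrA.
Qed.

(** With V the evaluations of the basis at separating points and Y V = 1, [M g] = ([M g] V^T) Y^T.
    The entries of [M g] V^T are values of the bounded functions [b i], so the bound does not depend
    on [g]. *)
Lemma coord_mx_bounded : exists C : R, forall g, sqnorm (M g) <= C.
Proof.
have [|m [z /row_fullP[Y YV]]] :=
    @separating_points R (X * A)%type n (fun i z => b i z.1 z.2).
  move=> c c0; apply: coord_inj => x a; rewrite (c0 (x, a)) big1 // => i _.
  by rewrite mul0r.
have /choice[beta betaP] i : exists beta : R, forall x a, `|b i x a| <= beta.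
  exact/span_orbit_bounded/span_orbit_basis.
exists ((\sum_(i < n) \sum_(k < m) beta i ^+ 2) * sqnorm Y^T) => g.
pose N := \matrix_(i, k) b i (act g (z k).1) (z k).2 : 'M[R]_(n, m).
have -> : M g = N *m Y^T.
  rewrite -[LHS]mulmx1 -trmx1 -YV trmx_mul mulmxA; congr (_ *m _).
  apply/matrixP => i k; rewrite !mxE M_coord.
  by apply: eq_bigr => j _; rewrite !mxE.
apply: le_trans (sqnorm_mul _ _) _; rewrite ler_wpM2r ?sqnorm_ge0 //.
apply: ler_sum => i _; apply: ler_sum => k _; rewrite mxE.
have b_le := betaP i (act g (z k).1) (z k).2.
by rewrite -real_normK ?num_real // lerXn2r ?nnegrE // (le_trans _ b_le).
Qed.

Lemma coord_box : exists p : 'rV[R]_n, forall g x a,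
  P (act g x) a = (p *m M g *m \col_j b j x a) 0 0.
Proof.
have [c cP] : exists c : 'I_n -> R, P = \sum_i c i *: b i.
  apply: linear_span_range; rewrite b_span; apply: sub_linear_span.
  by exists 1%g => //; apply/funext => x /=; rewrite act_left.1.
exists (\row_i c i) => g x a; rewrite {1}cP eval_sum -mulmxA mxE.
apply: eq_bigr => i _; rewrite !mxE M_coord; congr (_ * _).
by apply: eq_bigr => j _; rewrite mxE.
Qed.

End Coordinates.

End BoxSpace.

(** * Conjugation to an orthogonal representation *)

Theorem theorem1 (R : realType) (G : topologicalGroupType) (X : Type)
    (A : finType) (act : G -> X -> X) (x0 : X) (P : X -> A -> R^o) :
  locally_compact [set: G] ->
  transitive_action act ->
  black_box P ->
  finite_dimensional (linear_span (box_orbit act P)) ->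
  exists (D : nat) (T : G -> 'M[R]_D),
    orthogonal_representation T /\
    exists k : A -> 'I_D -> 'I_D -> R,
      forall (g : G) (a : A),
        P (act g x0) a = \sum_(i < D) \sum_(j < D) k a i j * T g i j.
Proof.
move=> _ [act_left _] P_box [n [b [b_free b_span]]].
have [M M_coord] := coord_mx act_left b_span.
have M1 := coord_mx1 act_left b_free M_coord.
have MM := coord_mxM act_left b_free M_coord.
have [C M_le] := coord_mx_bounded P_box b_free b_span M_coord.
have [p p_box] := coord_box act_left b_span M_coord.
have [S [symS posS invS]] := invariant_form M1 MM M_le.
have [B Bu SE] := cholesky symS posS.
pose T g := B *m M g *m invmx B.
(* Conjugation by [B] carries the invariant form [S = B^T *m B] to the standard one. *)
have TT g : (T g)^T *m T g = 1%:M.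
  have -> : (T g)^T *m T g =
      (invmx B)^T *m ((M g)^T *m (B^T *m B) *m M g) *m invmx B.
    by rewrite /T !trmx_mul !mulmxA.
  by rewrite -SE invS SE mulmxA -trmx_mul mulmxV // trmx1 mul1mx mulmxV.
exists n, T; split.
  split=> [g||g h]; first by split; [|apply: mulmx1C]; exact: TT.
    by rewrite /T M1 mulmx1 mulmxV.
  by rewrite /T MM !mulmxA mulmxKV.
(* The row and column vectors absorb the change of basis, so the coefficients [k a] form the
   rank-one array q_i v_j. *)
pose q := p *m invmx B; pose v a := B *m \col_j b j x0 a.
exists (fun a i j => q 0 i * v a j 0) => g a; rewrite p_box.
have -> : p *m M g *m \col_j b j x0 a = q *m T g *m v a.
  by rewrite /q /T /v !mulmxA !mulmxKV.
rewrite mxE exchange_big; apply: eq_bigr => j _; rewrite mxE mulr_suml.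
by apply: eq_bigr => i _; rewrite mulrAC.
Qed.
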